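(* Let $\rho>0$, and let $R_0^*=1$ and, for $n\ge 1$, $\beta_n^*=B_\rho(R_{n-1}^* )$ and $R_n^*=V_\rho(R_{n-1}^* )$. Let $T\in\mathrm{Lip}(\rho)$, $T:C\to C$, let $x^0\in C$ and let $x^n=(1-\beta_n^* )x^0+\beta_n^*\,Tx^{n-1}$ for $n\ge 1$. Suppose that there exists $\kappa_0$ such that $\|x^0-Tx^n\|\le\kappa_0$ for all $n\in\mathbb N$. Then $\|x^n-Tx^n\|\le\kappa_0\,R_n^*$ for all $n\in\mathbb N$. Moreover, this bound is tight: for every $\rho>0$ and $\kappa_0>0$ there exist a map $T\in\mathrm{Lip}(\rho)$, $T:C\to C$, and a corresponding sequence $(x^n)_{n\in\mathbb N}$ generated from some $x^0\in C$ by the iteration $x^n=(1-\beta_n^* )x^0+\beta_n^*\,Tx^{n-1}$ for $n\ge 1$ such that $\|x^0-Tx^n\|\le\kappa_0$ for all $n\in\mathbb N$ and $\|x^n-Tx^n\|=\kappa_0\,R_n^*$ for all $n\in\mathbb N$.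
   Context: $\mathbb N=\{0,1,2,\dots\}$. For $\rho>0$, $\mathrm{Lip}(\rho)$ is the class of all maps $T:C\to C$, where $C$ is a nonempty convex subset (not necessarily bounded or closed) of an arbitrary real normed space $(X,\|\cdot\|)$ (not necessarily complete), such that $\|Tx-Ty\|\le\rho\|x-y\|$ for all $x,y\in C$. For $r\in[0,1]$ define $$V_\rho(r)=\min_{\beta\in[0,1]}\;1-\beta+\rho\beta^2+\rho\beta(r-1),$$ whose minimizer over $[0,1]$ is $B_\rho(r)=\min\{1,\tfrac12(1/\rho+1-r)\}$. *)

(* Defs.v *)
From HB Require Import structures.
From mathcomp Require Import all_boot all_order all_algebra.
From mathcomp Require Import all_classical all_reals all_analysis.
From mathcomp Require Import ring lra.
Set Implicit Arguments.
Unset Strict Implicit.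
Unset Printing Implicit Defensive.
Import Order.TTheory GRing.Theory Num.Theory.
Import numFieldNormedType.Exports.
Local Open Scope classical_set_scope.
Local Open Scope ring_scope.

(* A map C -> C is encoded as a total T : X -> X leaving C stable; its values
   outside C are irrelevant. *)
Definition Lip (R : realType) (rho : R) (X : normedModType R) (C : set X)
    (T : X -> X) : Prop :=
  [/\ C !=set0, convex_set C, set_fun C C T & rho.-lipschitz_C T].

Definition obj (R : realType) (rho r beta : R) : R :=
  1 - beta + rho * beta ^+ 2 + rho * beta * (r - 1).

(* The infimum is attained, hence a minimum: see V_min below. *)
Definition V (R : realType) (rho r : R) : R :=
  inf [set obj rho r beta | beta in `[0, 1]].

Definition B (R : realType) (rho r : R) : R :=
  Num.min 1 (2^-1 * (rho^-1 + 1 - r)).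

Fixpoint Rstar (R : realType) (rho : R) (n : nat) : R :=
  if n is n'.+1 then V rho (Rstar rho n') else 1.

(* Meaningful for 1 <= n only; the value at n = 0 is never used. *)
Definition betastar (R : realType) (rho : R) (n : nat) : R :=
  B rho (Rstar rho n.-1).

Fixpoint halpern (R : realType) (X : normedModType R) (beta : nat -> R)
    (T : X -> X) (x0 : X) (n : nat) : X :=
  if n is n'.+1
  then (1 - beta n) *: x0 + beta n *: T (halpern beta T x0 n')
  else x0.

Lemma B_itv (R : realType) (rho r : R) :
  0 < rho -> 0 <= r <= 1 -> 0 <= B rho r <= 1.
Proof.
move=> rho0 /andP[r0 r1]; have ri : 0 < rho^-1 by rewrite invr_gt0.
by rewrite /B ge_min lexx/= le_min ler01/= andbT; lra.
Qed.

Lemma obj_B_le (R : realType) (rho r beta : R) : 0 < rho -> 0 <= r <= 1 ->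
  0 <= beta <= 1 -> obj rho r (B rho r) <= obj rho r beta.
Proof.
move=> rho0 /andP[r0 r1] /andP[b0 b1].
have rhoV : rho * rho^-1 = 1 by rewrite divff// gt_eqF.
rewrite /obj /B; set s := rho^-1 in rhoV *; clearbody s; rewrite -subr_ge0.
case: (leP 1 (2^-1 * (s + 1 - r))) => hB.
- have h : 0 <= rho * (s - beta - r) by apply: mulr_ge0; lra.
  have -> : 1 - beta + rho * beta ^+ 2 + rho * beta * (r - 1) -
      (1 - 1 + rho * 1 ^+ 2 + rho * 1 * (r - 1)) =
      (1 - beta) * (1 - rho * (beta + r)) by ring.
  by rewrite mulr_ge0//; lra.
- have -> : 1 - beta + rho * beta ^+ 2 + rho * beta * (r - 1) -
      (1 - 2^-1 * (s + 1 - r) + rho * (2^-1 * (s + 1 - r)) ^+ 2 +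
       rho * (2^-1 * (s + 1 - r)) * (r - 1)) =
      rho * (beta - 2^-1 * (s + 1 - r)) ^+ 2 +
      (rho * s - 1) * (beta - 2^-1 * (s + 1 - r)) by field.
  by rewrite rhoV subrr mul0r addr0 mulr_ge0 ?sqr_ge0// ltW.
Qed.

Lemma V_min (R : realType) (rho r : R) : 0 < rho -> 0 <= r <= 1 ->
  V rho r = obj rho r (B rho r).
Proof.
move=> rho0 r01.
have lbB : lbound [set obj rho r beta | beta in `[0, 1]] (obj rho r (B rho r)).
  by move=> _ [b + <-]; rewrite /= in_itv/= => b01; exact: obj_B_le.
have inB : [set obj rho r beta | beta in `[0, 1]] (obj rho r (B rho r)).
  by exists (B rho r) => //; rewrite /= in_itv/=; exact: B_itv.
apply/eqP; rewrite eq_le; apply/andP; split.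
- by apply: ge_inf => //; exists (obj rho r (B rho r)).
- by apply: lb_le_inf => //; exists (obj rho r (B rho r)).
Qed.

(* Hence only the values of V on [0, 1] matter. The bound 1 - rho^-1 is needed
   for the induction: V rho may be negative near 0 when 1 < rho. *)
Lemma Rstar_itv (R : realType) (rho : R) (n : nat) : 0 < rho ->
  [&& 1 - rho^-1 <= Rstar rho n, 0 <= Rstar rho n & Rstar rho n <= 1].
Proof.
move=> rho0; have s0 : 0 < rho^-1 by rewrite invr_gt0.
have rhoV : rho * rho^-1 = 1 by rewrite divff// gt_eqF.
elim: n => [|n /and3P[rs r0 r1]] /=; first by apply/and3P; split; lra.
have r01 : 0 <= Rstar rho n <= 1 by rewrite r0.
have V1 : V rho (Rstar rho n) <= 1.
  have := obj_B_le rho0 r01 (beta := 0); rewrite -(V_min rho0 r01) /obj.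
  by rewrite lexx ler01 expr0n/= !mulr0 mul0r !addr0 subr0; exact.
suff [Vs V0] : 1 - rho^-1 <= V rho (Rstar rho n) /\ 0 <= V rho (Rstar rho n).
  by apply/and3P; split.
rewrite (V_min rho0 r01) /obj; move: (B_itv rho0 r01).
move: (B rho _) => b /andP[b0 b1] {r01 V1 r1}; move: (Rstar rho n) r0 rs => r r0 rs.
set s := rho^-1 in s0 rhoV rs *; clearbody s.
have Vs : 1 - s <= 1 - b + rho * b ^+ 2 + rho * b * (r - 1).
  rewrite -subr_ge0.
  have -> : 1 - b + rho * b ^+ 2 + rho * b * (r - 1) - (1 - s) =
      rho * (b - s) ^+ 2 + rho * b * (r - (1 - s)) +
      (1 - rho * s) * (s - b) by ring.
  rewrite rhoV subrr mul0r addr0; apply: addr_ge0.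
    by rewrite mulr_ge0 ?sqr_ge0// ltW.
  by apply: mulr_ge0; [rewrite mulr_ge0// ltW | lra].
split => //; have [s1|s1] := leP s 1; first by apply: le_trans Vs; lra.
have rhole : rho <= 1 by rewrite -rhoV ler_peMr// ltW.
have -> : 1 - b + rho * b ^+ 2 + rho * b * (r - 1) =
    (1 - b) * (1 - rho * b) + rho * b * r by ring.
have rb : rho * b <= 1 by apply: mulr_ile1; lra.
have rho0W := ltW rho0.
by apply: addr_ge0; apply: mulr_ge0; rewrite ?mulr_ge0//; lra.
Qed.

(* Main.v *)
Require Import Defs.
From HB Require Import structures.
From mathcomp Require Import all_boot all_order all_algebra.
From mathcomp Require Import all_classical all_reals all_analysis.
From mathcomp Require Import ring lra.
Set Implicit Arguments.
Unset Strict Implicit.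
Unset Printing Implicit Defensive.
Import Order.TTheory GRing.Theory Num.Theory.
Import numFieldNormedType.Exports.
Local Open Scope classical_set_scope.
Local Open Scope ring_scope.

(* Upper bound: R* is nonincreasing, so beta* is nondecreasing, and induction
   gives |x^(n+1) - x^n| <= kappa0 d_n with d_n = beta*_(n+1) - 1 + R*_n,
   because
   x^(n+2) - x^(n+1) = beta*_(n+1) (T x^(n+1) - T x^n)
                       - (beta*_(n+2) - beta*_(n+1)) (x^0 - T x^(n+1))
   and R*_(n+1) = 1 - beta*_(n+1) + rho beta*_(n+1) d_n.
   Tightness: in l^oo take x^0 = 0 and the map sending u to
   (kappa0, (max 0 (kappa0 - rho |u_k - kappa0 beta*_(k+1)|))_k).
   Along its Halpern iterates (T x^n)_n = kappa0, so that
   (x^(n+1))_n = kappa0 beta*_(n+1) hits the next peak, whereas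
   (x^n)_n = kappa0 (1 - R*_n): the residual is already attained at
   coordinate n. *)

(** Lets the extremal map be truncated at 0 without increasing its Lipschitz constant. *)
Lemma ler_dist_maxr0 (R : realDomainType) (a b : R) :
  `|Num.max 0 a - Num.max 0 b| <= `|a - b|.
Proof.
have := ler_norm (a - b); have := ler_norm (b - a); rewrite (distrC b).
by move=> ? ?; rewrite ler_norml; case: (leP 0 a); case: (leP 0 b); lra.
Qed.

(** * Monotonicity of the coefficients and recursion for the step bounds *)

Section coefficients.
Variables (R : realType) (rho : R).
Hypothesis rho0 : 0 < rho.

Let Rstar01 n : 0 <= Rstar rho n <= 1.
Proof. by have /and3P[_ -> ->] := Rstar_itv n rho0. Qed.

Lemma betastar_itv n : 0 <= betastar rho n <= 1.
Proof. exact: B_itv. Qed.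

(** As R* <= 1, the second argument of the minimum is at least 1/(2 rho). Strictness permits
    cancelling beta* in [rho_step_le1]. *)
Lemma betastar_gt0 n : 0 < betastar rho n.
Proof.
rewrite /betastar /B lt_min ltr01/=.
have := Rstar01 n.-1; have : 0 < rho^-1 by rewrite invr_gt0.
by move=> ? /andP[_ ?]; lra.
Qed.

Lemma RstarS n :
  Rstar rho n.+1 = obj rho (Rstar rho n) (betastar rho n.+1).
Proof. by rewrite /= V_min. Qed.

(** The previous minimizer beta*_(n+1) is admissible in the next minimum, and [obj] is nondecreasing
    in r because rho beta >= 0. The induction starts from R*_1 <= 1 = R*_0. *)
Lemma Rstar_nonincreasing n : Rstar rho n.+1 <= Rstar rho n.
Proof.
elim: n => [|n IH]; first by have /andP[] := Rstar01 1.
rewrite [leRHS]RstarS /= V_min//.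
apply: le_trans (obj_B_le rho0 (Rstar01 n.+1) (betastar_itv n.+1)) _.
rewrite /obj lerD2l ler_wpM2l ?lerD2r// mulr_ge0 ?(ltW rho0)//.
  by case/andP: (betastar_itv n.+1).
exact: (Rstar01 n.+1).
Qed.

Lemma betastar_nondecreasing n : betastar rho n.+1 <= betastar rho n.+2.
Proof.
have := Rstar_nonincreasing n.
rewrite /betastar /B [_.+2.-1]/= [_.+1.-1]/= => h.
by rewrite le_min ge_min lexx/= ge_min; apply/orP; right; lra.
Qed.

(* The d_n of the header. *)
Definition step n : R := betastar rho n.+1 - 1 + Rstar rho n.

Lemma RstarSE n : Rstar rho n.+1 =
  1 - betastar rho n.+1 + rho * betastar rho n.+1 * step n.
Proof. by rewrite RstarS /obj /step; ring. Qed.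

(** The two terms mirror those of x^(n+2) - x^(n+1): the change of beta*, and the Lipschitz bound
    applied to the previous step. *)
Lemma stepS n : step n.+1 = betastar rho n.+2 - betastar rho n.+1 +
  rho * betastar rho n.+1 * step n.
Proof. by rewrite {1}/step RstarSE; ring. Qed.

Lemma step_ge0 n : 0 <= step n.
Proof.
elim: n => [|n IH].
  by rewrite /step /= subrK; have /andP[] := betastar_itv 1.
rewrite stepS addr_ge0 ?subr_ge0 ?betastar_nondecreasing//.
by rewrite !mulr_ge0 ?(ltW rho0) ?(ltW (betastar_gt0 _)).
Qed.

(** Read off from R*_(n+1) <= 1 after cancelling beta*_(n+1). It keeps the truncation at 0 inactive
    along the diagonal of the extremal iterates. *)
Lemma rho_step_le1 n : rho * step n <= 1.
Proof.
have /andP[_] := Rstar01 n.+1.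
rewrite RstarSE -lerBrDl opprB addrC subrK mulrAC.
by rewrite -[leRHS]mul1r ler_pM2r ?betastar_gt0.
Qed.

End coefficients.

(** * Upper bound on the residual in an arbitrary normed space *)

Section upper_bound.
Variables (R : realType) (rho : R) (X : normedModType R) (C : set X).
Variables (T : X -> X) (x0 : X) (kappa0 : R).
Hypotheses (rho0 : 0 < rho) (TC : Lip rho C T) (Cx0 : C x0).
Let x := halpern (betastar rho) T x0.
Hypothesis x0T : forall n, `|x0 - T (x n)| <= kappa0.

Let LipT a b : C a -> C b -> `|T a - T b| <= rho * `|a - b|.
Proof. by case: TC => _ _ _ + Ca Cb => /(_ (a, b)); apply. Qed.

Lemma halpern_mem n : C (x n).
Proof.
case: TC => _ convC stabC _; elim: n => [//|n Cn].
have /andP[b0 b1] := betastar_itv rho0 n.+1.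
have l01 : 0 <= 1 - betastar rho n.+1 <= 1 by lra.
have := convC _ _ (Itv01 (proj1 (andP l01)) (proj2 (andP l01)))
  (mem_set Cx0) (mem_set (stabC _ Cn)).
(* The convexity weight is that of the first point x^0, so T x^n receives 1 - (1 - beta). *)
suff -> : x n.+1 = (1 - betastar rho n.+1) *: x0 +
    (1 - (1 - betastar rho n.+1)) *: T (x n) by rewrite inE.
by rewrite subKr.
Qed.

Let normZ (a : R) n : 0 <= a -> `|a *: (x0 - T (x n))| <= kappa0 * a.
Proof.
by move=> a0; rewrite normrZ ger0_norm// mulrC ler_wpM2r.
Qed.

(** Written as a displacement from x^0, the iteration involves the vectors x^0 - T x^n, whose norms
    are bounded by hypothesis. *)
Lemma halpernS n :
  x n.+1 = x0 - betastar rho n.+1 *: (x0 - T (x n)).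
Proof.
rewrite /x/= scalerBl scale1r scalerBr opprB -addrA.
by congr (_ + _); rewrite addrC.
Qed.

Lemma halpern_step n : `|x n.+1 - x n| <= kappa0 * step rho n.
Proof.
elim: n => [|n IH].
  (* Here d_0 = beta*_1, since R*_0 = 1, and x^1 - x^0 = - beta*_1 (x^0 - T x^0). *)
  rewrite halpernS [x in _ - x]/= addrAC subrr add0r normrN /step /= subrK.
  by rewrite normZ//; case/andP: (betastar_itv rho0 1).
have /andP[b0 _] := betastar_itv rho0 n.+1.
have -> : x n.+2 - x n.+1 =
    betastar rho n.+1 *: (T (x n.+1) - T (x n)) -
    (betastar rho n.+2 - betastar rho n.+1) *: (x0 - T (x n.+1)).
  rewrite (halpernS n.+1) [x n.+1 in X in _ - X]halpernS.
  have -> : T (x n.+1) - T (x n) = (x0 - T (x n)) - (x0 - T (x n.+1)).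
    by rewrite opprB [RHS]addrC addrA subrK.
  move: (x0 - T (x n)) (x0 - T (x n.+1)) => p q.
  by rewrite scalerBr scalerBl !opprB [LHS]addrC !addrA !subrK.
rewrite stepS// mulrDr [leRHS]addrC (le_trans (ler_normB _ _))//.
rewrite lerD//; last first.
  by rewrite normZ// subr_ge0 betastar_nondecreasing.
rewrite normrZ ger0_norm//.
apply: le_trans (ler_wpM2l b0 (LipT (halpern_mem _) (halpern_mem _))) _.
by rewrite -mulrA mulrCA [leRHS]mulrCA ler_pM2l// [leRHS]mulrCA ler_wpM2l.
Qed.

(** With b = beta*_(n+1), x^(n+1) - T x^(n+1) = b (T x^n - T x^(n+1)) + (1 - b) (x^0 - T x^(n+1)).
    The Lipschitz condition and the step bound control the first term, the hypothesis the second,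
    and [RstarSE] adds them up. At n = 0 the claim is the hypothesis itself. *)
Lemma halpern_residual n : `|x n - T (x n)| <= kappa0 * Rstar rho n.
Proof.
case: n => [|n]; first by rewrite mulr1.
have /andP[b0 b1] := betastar_itv rho0 n.+1.
have -> : x n.+1 - T (x n.+1) =
    betastar rho n.+1 *: (T (x n) - T (x n.+1)) +
    (1 - betastar rho n.+1) *: (x0 - T (x n.+1)).
  rewrite [X in X - _]halpernS addrAC.
  have -> : T (x n) - T (x n.+1) = (x0 - T (x n.+1)) - (x0 - T (x n)).
    by rewrite opprB [RHS]addrC addrA subrK.
  move: (x0 - T (x n)) (x0 - T (x n.+1)) => p q.
  by rewrite scalerBr scalerBl scale1r [RHS]addrC addrA subrK.
rewrite RstarSE// addrC mulrDr (le_trans (ler_normD _ _))// lerD//.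
  by rewrite normZ// subr_ge0.
rewrite normrZ ger0_norm// distrC.
apply: le_trans (ler_wpM2l b0 (LipT (halpern_mem _) (halpern_mem _))) _.
rewrite -mulrA mulrCA [leRHS]mulrCA ler_pM2l// [leRHS]mulrCA.
by rewrite ler_wpM2l// halpern_step.
Qed.

End upper_bound.

(** * The space of bounded real sequences with the supremum norm *)

Definition bounded_seq (R : realType) : {pred nat -> R} :=
  [pred u | `[< exists M, forall n, `|u n| <= M >]].

Arguments bounded_seq : clear implicits.

Lemma bounded_seqP (R : realType) (u : nat -> R) :
  reflect (exists M, forall n, `|u n| <= M) (u \in bounded_seq R).
Proof. by rewrite unfold_in; exact: asboolP. Qed.

Lemma bounded_seq_submod (R : realType) : submod_closed (bounded_seq R).
Proof.
split; first by apply/bounded_seqP; exists 0 => n; rewrite normr0.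
move=> a u v /bounded_seqP[M uM] /bounded_seqP[N vN].
apply/bounded_seqP; exists (`|a| * M + N) => n.
by rewrite (le_trans (ler_normD _ _))// lerD// normrM ler_wpM2l.
Qed.

HB.instance Definition _ (R : realType) :=
  GRing.isSubmodClosed.Build R (nat -> R) (bounded_seq R)
    (bounded_seq_submod R).

Record linf (R : realType) :=
  Linf { linf_val : nat -> R ; linf_valP : linf_val \in bounded_seq R }.

HB.instance Definition _ (R : realType) := [isSub of linf R for @linf_val R].
HB.instance Definition _ (R : realType) := [Choice of linf R by <:].
HB.instance Definition _ (R : realType) :=
  [SubChoice_isSubLmodule of linf R by <:].

Section linf_norm.
Variable R : realType.
Implicit Types u v : linf R.

Definition linf_norm u : R := sup (range (fun n => `|linf_val u n|)).

Lemma linf_norm_ub u n : `|linf_val u n| <= linf_norm u.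
Proof.
have /bounded_seqP[M uM] := linf_valP u.
by apply: ub_le_sup; [exists M => _ [k _ <-] | exists n].
Qed.

Lemma linf_norm_le u M : (forall n, `|linf_val u n| <= M) -> linf_norm u <= M.
Proof.
move=> uM; apply: ge_sup => [|_ [k _ <-]//].
by exists `|linf_val u 0|, 0%N.
Qed.

Lemma linf_normD u v : linf_norm (u + v) <= linf_norm u + linf_norm v.
Proof.
apply: linf_norm_le => n.
by rewrite (le_trans (ler_normD _ _))// lerD// linf_norm_ub.
Qed.

(** For nonzero a the lower bound follows by dividing each coordinate by |a|; for a = 0 it is the
    nonnegativity of the norm. *)
Lemma linf_normZ (a : R) u : linf_norm (a *: u) = `|a| * linf_norm u.
Proof.
apply/le_anti/andP; split.
  by apply: linf_norm_le => n; rewrite normrM ler_wpM2l// linf_norm_ub.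
have [->|a0] := eqVneq a 0.
  by rewrite normr0 mul0r (le_trans _ (linf_norm_ub _ 0%N)).
rewrite mulrC -ler_pdivlMr ?normr_gt0//; apply: linf_norm_le => n.
by rewrite ler_pdivlMr ?normr_gt0// mulrC -normrM (linf_norm_ub (a *: u)).
Qed.

Lemma linf_norm_eq0 u : linf_norm u = 0 -> u = 0.
Proof.
move=> u0; apply/val_inj/funext => n; apply/eqP.
by rewrite -normr_le0 -u0 linf_norm_ub.
Qed.

HB.instance Definition _ :=
  Lmodule_isNormed.Build R (linf R) linf_normD linf_normZ linf_norm_eq0.

Lemma linf_valB u v n : linf_val (u - v) n = linf_val u n - linf_val v n.
Proof. by []. Qed.

Lemma linf_normE u : `|u| = linf_norm u. Proof. by []. Qed.

End linf_norm.

(** * A map attaining the bound at every iteration *)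

Section extremal_map.
Variables (R : realType) (rho kappa : R).
Hypotheses (rho0 : 0 < rho) (kappa0 : 0 < kappa).

Definition extremal_seq (u : nat -> R) (n : nat) : R :=
  if n is k.+1 then Num.max 0 (kappa - rho * `|u k - kappa * betastar rho k.+1|)
  else kappa.

(** The truncation at 0 supplies the lower bound. Every image is thus a bounded sequence within
    distance kappa of x^0 = 0. *)
Lemma extremal_seq_itv u n : 0 <= extremal_seq u n <= kappa.
Proof.
case: n => [|n] /=; first by rewrite lexx ltW.
rewrite le_max lexx/= ge_max (ltW kappa0)/= gerBl.
by rewrite mulr_ge0// ltW.
Qed.

Lemma extremal_seq_normr u n : `|extremal_seq u n| <= kappa.
Proof. by have /andP[h0 h1] := extremal_seq_itv u n; rewrite ger0_norm. Qed.

Lemma extremal_seq_bounded u : extremal_seq u \in bounded_seq R.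
Proof. by apply/bounded_seqP; exists kappa; exact: extremal_seq_normr. Qed.

Definition extremal (u : linf R) : linf R :=
  Linf (extremal_seq_bounded (linf_val u)).

Lemma extremal_coordS u n : linf_val (extremal u) n.+1 =
  Num.max 0 (kappa - rho * `|linf_val u n - kappa * betastar rho n.+1|).
Proof. by []. Qed.

(** Coordinate 0 of the image is constant; each other one depends on a single coordinate of u,
    through a truncated tent of slope rho. *)
Lemma extremal_Lip : Lip rho setT extremal.
Proof.
split => //; first by exists 0.
suff Tuv u v : `|extremal u - extremal v| <= rho * `|u - v|.
  by move=> [u v] _; exact: Tuv.
rewrite [leLHS]linf_normE; apply: linf_norm_le => -[|n].
  by rewrite linf_valB subrr normr0 mulr_ge0// ltW.
rewrite linf_valB; apply: le_trans (ler_dist_maxr0 _ _) _.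
rewrite opprB addrC addrA subrK -mulrBr normrM gtr0_norm// ler_pM2l//.
apply: le_trans (ler_dist_dist _ _) _.
rewrite opprB addrA subrK distrC.
by rewrite -linf_valB linf_norm_ub.
Qed.

Let x := halpern (betastar rho) extremal 0.

Lemma extremal_halpern_coordS n k : linf_val (x n.+1) k =
  betastar rho n.+1 * linf_val (extremal (x n)) k.
Proof. by rewrite /x/= scaler0 add0r. Qed.

Lemma extremal_halpern_image n : linf_val (extremal (x n)) n = kappa.
Proof.
elim: n => [//|n IH]; rewrite extremal_coordS extremal_halpern_coordS IH.
by rewrite [_ * kappa]mulrC subrr normr0 mulr0 subr0; apply/max_idPr/ltW.
Qed.

(** The peak kappa beta*_(n+1) lies at distance kappa d_n from kappa (1 - R*_n), so the tent takes
    the value kappa (1 - rho d_n) there, and beta*_(n+1) (1 - rho d_n) = 1 - R*_(n+1). *)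
Lemma extremal_halpern_diag n :
  linf_val (x n) n = kappa * (1 - Rstar rho n).
Proof.
elim: n => [|n IH]; first by rewrite [Rstar _ _]/= subrr mulr0.
rewrite extremal_halpern_coordS extremal_coordS IH -mulrBr.
rewrite normrM gtr0_norm// distrC.
have -> : betastar rho n.+1 - (1 - Rstar rho n) = step rho n.
  by rewrite /step; ring.
rewrite ger0_norm ?step_ge0//.
have -> : kappa - rho * (kappa * step rho n) = kappa * (1 - rho * step rho n).
  by ring.
have /max_idPr -> : 0 <= kappa * (1 - rho * step rho n).
  by rewrite mulr_ge0 ?(ltW kappa0)// subr_ge0 rho_step_le1.
by rewrite RstarSE//; ring.
Qed.

Lemma extremal_dist0 n : `|0 - extremal (x n)| <= kappa.
Proof.
rewrite sub0r normrN linf_normE.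
by apply: linf_norm_le => k; exact: extremal_seq_normr.
Qed.

Lemma extremal_residual n : `|x n - extremal (x n)| = kappa * Rstar rho n.
Proof.
apply/le_anti/andP; split.
  (* This half is the general upper bound, with C the whole space. *)
  exact: (halpern_residual rho0 extremal_Lip I extremal_dist0).
have /and3P[_ R0 _] := Rstar_itv n rho0.
apply: le_trans (linf_norm_ub (x n - extremal (x n)) n).
rewrite linf_valB extremal_halpern_diag extremal_halpern_image.
have -> : kappa * (1 - Rstar rho n) - kappa = - (kappa * Rstar rho n) by ring.
by rewrite normrN ler_norm.
Qed.

End extremal_map.

Theorem theorem3 (R : realType) :
  (forall rho : R, 0 < rho ->
   forall (X : normedModType R) (C : set X) (T : X -> X) (x0 : X) (kappa0 : R),
     Lip rho C T -> C x0 ->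
     let x := halpern (betastar rho) T x0 in
     (forall n : nat, `|x0 - T (x n)| <= kappa0) ->
     forall n : nat, `|x n - T (x n)| <= kappa0 * Rstar rho n)
  /\
  (forall rho kappa0 : R, 0 < rho -> 0 < kappa0 ->
   exists (X : normedModType R) (C : set X) (T : X -> X) (x0 : X),
     let x := halpern (betastar rho) T x0 in
     [/\ Lip rho C T, C x0,
         forall n : nat, `|x0 - T (x n)| <= kappa0
       & forall n : nat, `|x n - T (x n)| = kappa0 * Rstar rho n]).
Proof.
split=> [rho rho0 X C T x0 kappa0 TC Cx0 x x0T n|rho kappa0 rho0 kappa0_gt0].
  exact: (halpern_residual rho0 TC Cx0 x0T).
exists (linf R), setT, (extremal rho0 kappa0_gt0), 0; split => //.
- exact: extremal_Lip.
- exact: extremal_dist0.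
- exact: extremal_residual.
Qed.
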